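(* For every integer $k\geq1$, every real $\nu\geq1$, and every $u\in\mathbb{C}^k$ with $|u|=1$, $$\int_{[0,1]^k}\big|\log|\langle a,u\rangle|\big|^\nu\,d\lambda_k(a)\leq(\log k)^\nu+6\,\nu^\nu .$$ (That is, this bounds the $\nu$-th logarithmic moments of the probability measure $d\sigma_k=\chi_{[0,1]^k}\,d\lambda_k$ on $\mathbb{R}^k\subset\mathbb{C}^k$, where $\chi_{[0,1]^k}$ is the characteristic function of $[0,1]^k$.)
   Context: For $a,v\in\mathbb{C}^k$ with $a=(a_1,\ldots,a_k)$, $v=(v_1,\ldots,v_k)$, the (bilinear) pairing is $\langle a,v\rangle=\sum_{j=1}^k a_jv_j$ (no complex conjugation), and $|v|^2=\langle v,\overline v\rangle=\sum_{j=1}^k|v_j|^2$. $\lambda_k$ is the Lebesgue measure on $\mathbb{R}^k\subset\mathbb{C}^k$. The logarithm is the natural logarithm. *)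

(* Defs.v *)
From HB Require Import structures.
From mathcomp Require Import all_boot all_order all_algebra complex.
From mathcomp Require Import all_classical all_reals all_analysis.
Set Implicit Arguments.
Unset Strict Implicit.
Unset Printing Implicit Defensive.
Import Order.TTheory GRing.Theory Num.Theory.
Import ComplexField.Normc.
Local Open Scope classical_set_scope.
Local Open Scope ring_scope.

(* MathComp-Analysis has Lebesgue measure on the line only. The measure on R^k
   is built on [k.-tuple], whose measurable sets form the product
   sigma-algebra: it is the unit mass for k = 0, and the image of the product
   of the measures on R and R^k under (x, s) |-> x :: s for k + 1. The lemma
   [lebesgue_measure_tuple_box] gives its values on boxes. *)
Section lebesgue_measure_tuple.
Context {R : realType}.
Local Notation T := (measurableTypeR R).

Definition tuple_cons (k : nat) (x : T * k.-tuple T) : k.+1.-tuple T :=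
  [tuple of x.1 :: x.2].

Lemma measurable_tuple_cons k : measurable_fun setT (@tuple_cons k).
Proof. exact: (measurable_cons (f := fst) (g := snd)). Qed.

Definition cons_measure (k : nat) (m : set (k.-tuple T) -> \bar R) :
    set (k.+1.-tuple T) -> \bar R :=
  pushforward (lebesgue_measure \x m)%E (@tuple_cons k).

Section cons_measure.
Variables (k : nat) (m : {sigma_finite_measure set (k.-tuple T) -> \bar R}).

Let measurable_preimage_cons A :
  measurable A -> measurable (@tuple_cons k @^-1` A).
Proof.
by move=> mA; rewrite -[X in measurable X]setTI; exact: measurable_tuple_cons.
Qed.

Let cons_measure0 : cons_measure m set0 = 0%E.
Proof. by rewrite /cons_measure /pushforward preimage_set0 measure0. Qed.

Let cons_measure_ge0 A : (0 <= cons_measure m A)%E.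
Proof. exact: (measure_ge0 (lebesgue_measure \x m)%E). Qed.

Let cons_measure_sigma_additive : semi_sigma_additive (cons_measure m).
Proof.
move=> F mF tF mUF; rewrite /cons_measure /pushforward preimage_bigcup.
apply: measure_semi_sigma_additive.
- by move=> n; exact: measurable_preimage_cons.
- apply/trivIsetP => /= i j _ _ ij; rewrite -preimage_setI.
  by move/trivIsetP : tF => /(_ _ _ _ _ ij) ->//; rewrite preimage_set0.
- by rewrite -preimage_bigcup; exact: measurable_preimage_cons.
Qed.

HB.instance Definition _ := isMeasure.Build _ _ _ (cons_measure m)
  cons_measure0 cons_measure_ge0 cons_measure_sigma_additive.

Let cons_measure_sigma_finite : sigma_finite setT (cons_measure m).
Proof.
have /sigma_finiteP[F [TF ndF Foo]] := sigma_finiteT (@lebesgue_measure R).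
have /sigma_finiteP[G [TG ndG Goo]] := sigma_finiteT m.
pose g (s : k.+1.-tuple T) : T * k.-tuple T := (thead s, [tuple of behead s]).
have mg : measurable_fun setT g.
  apply/measurable_fun_pair; last exact: measurable_behead.
  exact: measurable_tnth.
have gK : g \o @tuple_cons k = id.
  by apply/funext => -[x s]; congr pair; apply/val_inj.
exists (fun n => g @^-1` (F n `*` G n)).
  rewrite -preimage_bigcup (_ : \bigcup_n _ = setT) ?preimage_setT//.
  apply/seteqP; split=> // -[x s] _.
  have [i _ Fix] : (\bigcup_i F i) x by rewrite -TF.
  have [j _ Gjs] : (\bigcup_j G j) s by rewrite -TG.
  exists (maxn i j) => //; split.
  - by move: x Fix; exact/subsetPset/ndF/leq_maxl.
  - by move: s Gjs; exact/subsetPset/ndG/leq_maxr.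
move=> n; have [mF Fn] := Foo n; have [mG Gn] := Goo n; split.
  by rewrite -[X in measurable X]setTI; apply: mg => //; exact: measurableX.
rewrite /cons_measure /pushforward -comp_preimage gK preimage_id.
by rewrite product_measure1E// lte_mul_pinfty// ge0_fin_numE.
Qed.

HB.instance Definition _ := Measure_isSigmaFinite.Build _ _ _ (cons_measure m)
  cons_measure_sigma_finite.

End cons_measure.

Fixpoint lebesgue_measure_tuple (k : nat) : set (k.-tuple T) -> \bar R :=
  match k with
  | 0%N => dirac ([tuple] : 0.-tuple T)
  | k'.+1 => cons_measure (@lebesgue_measure_tuple k')
  end.

Let lebesgue_measure_tuple_subproof k :
  exists m : {sigma_finite_measure set (k.-tuple T) -> \bar R},
    @lebesgue_measure_tuple k = m.
Proof.
elim: k => [|k [m mE]] /=; first by exists (dirac ([tuple] : 0.-tuple T)).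
by rewrite mE; exists (cons_measure m).
Qed.

Section measure.
Variable k : nat.

Let lebesgue_measure_tuple0 : @lebesgue_measure_tuple k set0 = 0%E.
Proof. by have [m ->] := lebesgue_measure_tuple_subproof k. Qed.

Let lebesgue_measure_tuple_ge0 A : (0 <= @lebesgue_measure_tuple k A)%E.
Proof. by have [m ->] := lebesgue_measure_tuple_subproof k. Qed.

Let lebesgue_measure_tuple_sigma_additive :
  semi_sigma_additive (@lebesgue_measure_tuple k).
Proof.
have [m ->] := lebesgue_measure_tuple_subproof k.
exact: measure_semi_sigma_additive.
Qed.

HB.instance Definition _ := isMeasure.Build _ _ _ (@lebesgue_measure_tuple k)
  lebesgue_measure_tuple0 lebesgue_measure_tuple_ge0
  lebesgue_measure_tuple_sigma_additive.

Let lebesgue_measure_tuple_sigma_finite :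
  sigma_finite setT (@lebesgue_measure_tuple k).
Proof.
by have [m ->] := lebesgue_measure_tuple_subproof k; exact: sigma_finiteT.
Qed.

HB.instance Definition _ := Measure_isSigmaFinite.Build _ _ _
  (@lebesgue_measure_tuple k) lebesgue_measure_tuple_sigma_finite.

End measure.

Lemma lebesgue_measure_tuple_box k (A : 'I_k -> set T) :
  (forall i, measurable (A i)) ->
  lebesgue_measure_tuple [set s | forall i, A i (tnth s i)] =
  (\prod_(i < k) lebesgue_measure (A i))%E.
Proof.
elim: k A => [|k IH] A mA.
  rewrite big_ord0 /= diracE mem_set//; by case.
rewrite big_ord_recl /= /cons_measure /pushforward.
rewrite (_ : _ @^-1` _ =
    A ord0 `*` [set s | forall i, A (lift ord0 i) (tnth s i)]).
  rewrite product_measure1E//; last first.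
    rewrite (_ : [set _ | _] =
        \big[setI/setT]_(i < k) ((@tnth k T)^~ i @^-1` A (lift ord0 i))).
      apply: bigsetI_measurable => i _.
      by rewrite -[X in measurable X]setTI; exact: measurable_tnth.
    rewrite -bigcap_seq; apply/seteqP; split=> s /= h i; first by move=> _; exact: h.
    by apply: h; rewrite /= mem_index_enum.
  by congr (_ * _)%E; exact: (IH (fun i => A (lift ord0 i))).
apply/seteqP; split=> -[x s] /=.
  move=> h; split; first exact: (h ord0).
  by move=> i; have := h (lift ord0 i); rewrite tnthS.
move=> [h0 h] i; case: (unliftP ord0 i) => [j ->|->]; last exact: h0.
by rewrite tnthS; exact: h.
Qed.

End lebesgue_measure_tuple.
Arguments lebesgue_measure_tuple {R} k A.

Section complex_space.
Context {R : realType}.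
Local Open Scope complex_scope.

Definition cpairing (k : nat) (a v : k.-tuple R[i]) : R[i] :=
  \sum_(j < k) tnth a j * tnth v j.

Definition cnorm (k : nat) (v : k.-tuple R[i]) : R :=
  Num.sqrt (\sum_(j < k) normc (tnth v j) ^+ 2).

Lemma cpairing_conjc (k : nat) (v : k.-tuple R[i]) :
  cpairing v (map_tuple conjc v) = (cnorm v ^+ 2)%:C.
Proof.
rewrite /cnorm sqr_sqrtr; last by apply: sumr_ge0 => j _; exact: sqr_ge0.
rewrite rmorph_sum; apply: eq_bigr => j _; rewrite tnth_map.
case: (tnth v j) => a b /=; rewrite sqr_sqrtr ?addr_ge0 ?sqr_ge0//.
by simpc; rewrite -!expr2; congr (_ +i* _); rewrite mulrC addNr.
Qed.

Definition tuple_real_complex (k : nat) (a : k.-tuple R) : k.-tuple R[i] :=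
  map_tuple (fun x => x%:C) a.

End complex_space.

Definition unit_cube (R : realType) (k : nat) :
    set (k.-tuple (measurableTypeR R)) :=
  [set a | forall j, 0 <= tnth a j <= 1].
Arguments unit_cube : clear implicits.

(* Main.v *)
(* Let X = |<a,u>|, so X <= k on the cube, and pick j with |u_j| >= 1 / sqrt k.
   Then s = Re (<a,u> / u_j) is a_j plus a real form in the other coordinates,
   and |s| <= sqrt k * X, whence - log X <= (log k) / 2 + max (0, - log |s|).
   Convexity of x^nu, applied to the midpoint of log k and 2 max (0, - log |s|),
   together with (2 z)^nu <= nu^nu * exp (4 z / 5), gives
     |log X|^nu <= (log k)^nu + nu^nu / 2 * max (1, |s|^(- 4 / 5)).
   Integrating first in a_j, the average of max (1, |s|^(- 4 / 5)) is at most 12,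
   whatever the other coordinates are. *)
Require Import Defs.
From mathcomp Require Import all_boot all_order all_algebra complex.
From mathcomp Require Import all_classical all_reals all_analysis.
From mathcomp Require Import measurable_realfun ring lra zify.
Set Implicit Arguments.
Unset Strict Implicit.
Unset Printing Implicit Defensive.
Import Order.TTheory GRing.Theory Num.Theory.
Import ComplexField.Normc.
Local Open Scope classical_set_scope.
Local Open Scope ring_scope.

(** * Pointwise inequalities for powers and logarithms *)

Lemma expR1_ge5_2 (R : realType) : 5 / 2 <= expR 1 :> R.
Proof.
(* The bound [1 + x <= expR x] at [1] gives only 2; at [1 / 8], raised to the power 8, it gives
   [(9 / 8) ^+ 8], about 2.57. *)
have e8 : 9 / 8 <= expR (1 / 8) :> R by apply: le_trans (expR_ge1Dx _); lra.
have -> : 1 = 8 * (1 / 8) :> R by lra.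
rewrite expRM_natl.
have : (9 / 8) ^+ 8 <= expR (1 / 8) ^+ 8 :> R.
  by rewrite lerXn2r// nnegrE; [lra | exact: expR_ge0].
apply: le_trans; lra.
Qed.

(* With [t := 4 * z / (5 * nu)], this is [ln t <= t - 1] and [ln (5 / 2) <= 1]. *)
Lemma powR_double_le_expR (R : realType) (nu z : R) : 0 < nu -> 0 <= z ->
  (2 * z) `^ nu <= nu `^ nu * expR (4 / 5 * z).
Proof.
move=> nu0; rewrite le_eqVlt => /orP[/eqP <-|z0].
  by rewrite mulr0 powR0 ?gt_eqF// mulr_ge0 ?powR_ge0 ?expR_ge0.
rewrite /powR !gt_eqF ?mulr_gt0// -expRD ler_expR.
have t0 : 0 < 4 * z / (5 * nu) by rewrite divr_gt0 ?mulr_gt0.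
have -> : 2 * z = (5 / 2) * nu * (4 * z / (5 * nu)).
  by field; rewrite gt_eqF.
set t := 4 * z / (5 * nu) in t0 *.
have a0 : 0 < 5 / 2 :> R by lra.
have lnMp (x y : R) : 0 < x -> 0 < y -> ln (x * y) = ln x + ln y.
  by move=> x0 y0; rewrite lnM.
have a1 : 0 < 5 / 2 * nu by rewrite mulr_gt0.
rewrite (lnMp (5 / 2 * nu))// (lnMp (5 / 2))//.
have l1 : ln (5 / 2) <= 1 :> R.
  by rewrite -[leRHS]expRK ler_ln ?posrE ?expR_gt0 ?expR1_ge5_2//; lra.
have l2 : ln t <= t - 1.
  by rewrite -[X in ln X](subrKC 1) le_ln1Dx//; lra.
have -> : 4 / 5 * z = nu * t by rewrite /t; field; rewrite gt_eqF.
rewrite -mulrDr ler_pM2l//; lra.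
Qed.

Lemma powR_mean_le (R : realType) (nu x y : R) : 1 <= nu -> 0 <= x -> 0 <= y ->
  (x / 2 + y / 2) `^ nu <= x `^ nu / 2 + y `^ nu / 2.
Proof.
move=> nu1 x0 y0.
have i1 : 2^-1 <= 1 :> R by rewrite invf_le1 ?ler1n.
have i0 : 0 <= 2^-1 :> R by rewrite invr_ge0.
have half : 2^-1 = 1 - 2^-1 :> R by lra.
rewrite -![_ / 2]mulrC {2 4}half.
by apply: (convex_powR nu1 (Itv01 i0 i1)); rewrite inE/= in_itv/= andbT.
Qed.

(** The exponential is the maximum of 1 and |s|^(-4/5). For [1 <= X] the term in [ln K] alone
    suffices; for [X < 1] a small [X] forces a small [s], and the exponential pays for it. *)
Lemma powR_ln_le (R : realType) (nu K X s : R) :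
  1 <= nu -> 1 <= K -> 0 < X -> X <= K -> s != 0 -> `|s| <= Num.sqrt K * X ->
  `| ln X | `^ nu <=
  ln K `^ nu + nu `^ nu / 2 * expR (4 / 5 * Num.max 0 (- ln `|s|)).
Proof.
move=> nu1 K1 X0 XK s0 sX; have nu0 : 0 < nu by lra.
have K0 : 0 < K by lra.
have lK0 : 0 <= ln K by rewrite ln_ge0.
set z := Num.max _ _; have z0 : 0 <= z by rewrite /z le_max lexx.
have [X1|X1] := leP 1 X.
  rewrite ger0_norm ?ln_ge0// ler_wpDr//.
    by rewrite mulr_ge0 ?expR_ge0// mulr_ge0 ?powR_ge0.
  by rewrite ge0_ler_powR ?nnegrE ?ln_ge0 ?ler_ln ?posrE// ltW.
have s1 : ln `|s| <= ln K / 2 + ln X.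
  apply: (@le_trans _ _ (ln (Num.sqrt K * X))).
    by rewrite ler_ln// posrE ?normr_gt0// mulr_gt0// sqrtr_gt0.
  rewrite lnM ?posrE ?sqrtr_gt0// lerD2r -[in leRHS](sqr_sqrtr (ltW K0)).
  by rewrite lnXn ?sqrtr_gt0// -mulr_natr; lra.
have lX0 : ln X <= 0 by rewrite ln_le0// ltW.
have zs : - ln `|s| <= z by rewrite /z le_max lexx orbT.
(* The cancelling factors 2 exhibit the bound as the midpoint of [ln K] and [2 * z], ready for
   convexity. *)
have lX : `|ln X| <= ln K / 2 + (2 * z) / 2 by rewrite ler0_norm//; lra.
apply: (le_trans (ge0_ler_powR (ltW nu0) _ _ lX)); rewrite ?nnegrE//.
  by lra.
apply: (le_trans (powR_mean_le nu1 lK0 _)); first lra.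
(* Convexity leaves only half of the power of [ln K]; since that power is nonnegative, the full one
   bounds it. *)
have := powR_double_le_expR nu0 z0; have := powR_ge0 (ln K) nu.
rewrite mulrAC; lra.
Qed.

(** * A step function above |s|^(-4/5) and its integral *)

Lemma ltr_expn_unbounded (R : realType) (q A : R) : 1 < q -> exists n, A < q ^+ n.
Proof.
move=> q1; have lq : 0 < ln q by rewrite ln_gt0.
(* Since q^n = exp(n ln q) >= 1 + n ln q, any [n] above [A / ln q] will do. *)
exists (Num.bound `|A / ln q|).
rewrite -[X in X ^+ _]lnK ?posrE ?(lt_trans _ q1)// -expRM_natl.
apply: lt_le_trans (expR_ge1Dx _); rewrite ltr_wpDl//.
by rewrite -ltr_pdivrMr// (le_lt_trans (ler_norm _))// archi_boundP.
Qed.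

(* A step function above [`|s| `^ (- 4 / 5)] for [`|s| <= 1]: its value is
   [(10 / 9) ^+ (4 * n.+1)] where [(9 / 10) ^+ (5 * n.+1) < `|s| <= (9 / 10) ^+ (5 * n)].
   The ratio 9 / 10 is close enough to 1 to keep its integral below 12. *)
Definition step_majorant (R : realType) (s : R) : \bar R :=
  (1 + \sum_(0 <= n <oo)
    (((10 / 9) ^+ 4 - 1) * ((10 / 9) ^+ 4) ^+ n *
     \1_[set x | `|x| <= (9 / 10) ^+ (5 * n)] s)%:E)%E.

Section step_majorant.
Context (R : realType).
(** The exponents 4 and 5 keep all powers integral: [r n] to the power -4/5 is [q ^+ n], while
    [q ^+ n * r n] is [(9 / 10) ^+ n], which is summable. *)
Let q : R := (10 / 9) ^+ 4.
Let r (n : nat) : R := (9 / 10) ^+ (5 * n).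
Let term n (s : R) : \bar R := ((q - 1) * q ^+ n * \1_[set x | `|x| <= r n] s)%:E.

Let q1 : 1 < q.
Proof. rewrite /q; lra. Qed.

Let r_itv w n :
  [set x : R | `|w + x| <= r n] = [set` `[- w - r n, - w + r n]].
Proof. apply/seteqP; split => x /=; rewrite in_itv/= ler_norml; lra. Qed.

Let term_ge0 n s : (0 <= term n s)%E.
Proof.
by rewrite lee_fin !mulr_ge0// ?subr_ge0 ?exprn_ge0// ltW// (lt_trans _ q1).
Qed.

Let mterm n : measurable_fun [set: measurableTypeR R] (term n).
Proof.
apply/measurable_EFinP; apply: measurable_funM => //.
apply: measurable_indic.
rewrite (_ : [set _ | _] = [set` `[- r n, r n]])//.
by apply/seteqP; split => x /=; rewrite in_itv/= ler_norml.
Qed.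

Lemma measurable_step_majorant :
  measurable_fun [set: measurableTypeR R] (@step_majorant R).
Proof.
apply: emeasurable_funD; first exact: measurable_cst.
apply: ge0_emeasurable_sum => [n x _ _|n _]; [exact: term_ge0|exact: mterm].
Qed.

Lemma step_majorant_ge1 (s : R) : (1 <= step_majorant s)%E.
Proof. by rewrite leeDl//; apply: nneseries_ge0 => n _ _; exact: term_ge0. Qed.

(** As [r] decreases, the indicators of index 0 to [n] all equal 1 at [s], and the partial sum of
    the (q - 1) q^i telescopes to q^(n+1) - 1. *)
Lemma step_majorant_ge (s : R) n : `|s| <= r n -> ((q ^+ n.+1)%:E <= step_majorant s)%E.
Proof.
move=> sn.
have -> : q ^+ n.+1 = 1 + \sum_(0 <= i < n.+1) (q - 1) * q ^+ i.
  by rewrite -mulr_sumr big_mkord -subrX1 subrKC.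
rewrite EFinD leeD2l// -sumEFin.
apply: le_trans (nneseries_lim_ge n.+1 _) => /=; last first.
  by move=> i _ _; exact: term_ge0.
rewrite le_eqVlt; apply/orP; left; apply/eqP.
apply: eq_big_nat => i /andP[_ ilt].
rewrite /term indicE mem_set/= ?mulr1//.
apply: (le_trans sn); rewrite /r; apply: ler_wiXn2l; try lra.
by rewrite leq_mul2l/= -ltnS.
Qed.

(** Every indicator is 1 at the origin, so the series diverges. This settles the points where the
    real form vanishes, where no bound through [ln] is available. *)
Lemma step_majorant0 : step_majorant (0 : R) = +oo%E.
Proof.
apply/eqyP => A A0.
have [n An] := ltr_expn_unbounded A q1.
apply: le_trans (step_majorant_ge (n := n) _); last by rewrite normr0 exprn_ge0.
by rewrite lee_fin (le_trans (ltW An))// ler_weXn2l// ltW.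
Qed.

(** Take the least [n] with [r n.+1] below |s|. Then |s| is at most [r n], by minimality or, for
    [n = 0], because |s| < 1. So the majorant is at least [q ^+ n.+1], which is [r n.+1] to the
    power -4/5 and hence exceeds |s|^(-4/5). *)
Lemma expR_le_step_majorant (s : R) : s != 0 ->
  ((expR (4 / 5 * Num.max 0 (- ln `|s|)))%:E <= step_majorant s)%E.
Proof.
move=> s0.
have [s1|s1] := leP 1 `|s|.
  rewrite max_l ?mulr0 ?expR0 ?step_majorant_ge1// oppr_le0 ln_ge0//.
have sp : 0 < `|s| by rewrite normr_gt0.
have ex : exists n, r n.+1 < `|s|.
  have [n sn] := @ltr_expn_unbounded R (10 / 9) `|s|^-1 ltac:(lra).
  exists n; rewrite -[ltRHS]invrK /r (_ : 9 / 10 = (10 / 9)^-1); last lra.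
  rewrite exprVn ltf_pV2 ?posrE ?invr_gt0 ?exprn_gt0//.
  rewrite (lt_le_trans sn)// ler_weXn2l//; first lra.
  lia.
case: (ex_minnP ex) => n sn nmin.
apply: (@le_trans _ _ (q ^+ n.+1)%:E); last first.
  apply: step_majorant_ge; case: n nmin {sn} => [_|n nmin].
    by rewrite /r muln0 expr0 ltW.
  by rewrite leNgt; apply/negP => /nmin; rewrite ltnn.
have -> : Num.max 0 (- ln `|s|) = - ln `|s|.
  by rewrite max_r// oppr_ge0 ln_le0// ltW.
rewrite lee_fin -[leRHS]lnK ?posrE ?exprn_gt0// ler_expR.
have : ln (r n.+1) <= ln `|s| by rewrite ler_ln ?posrE ?exprn_gt0// ltW.
rewrite /r /q (_ : 9 / 10 = (10 / 9)^-1); last lra.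
rewrite exprVn lnV ?posrE ?exprn_gt0// -exprM !lnXn//.
rewrite ![(_ * n.+1)%N]mulnC !mulrnA.
lra.
Qed.

Lemma step_majorant_ge0 (s : R) : (0 <= step_majorant s)%E.
Proof. exact: le_trans (step_majorant_ge1 s). Qed.

(** Height times length [2 * r n] of the whole interval; dropping the intersection with [0, 1] makes
    the bound independent of [w]. *)
Let integral_term n w :
  (\int[lebesgue_measure]_(x in `[0%R, 1%R]) term n (w + x)%R
   <= (2 * (q - 1) * (9 / 10) ^+ n)%:E)%E.
Proof.
have c0 : 0 <= (q - 1) * q ^+ n.
  by rewrite mulr_ge0 ?subr_ge0 ?exprn_ge0// ltW// (lt_trans _ q1).
have r0 : 0 <= r n by rewrite exprn_ge0.
have -> : (fun x => term n (w + x)) =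
    (fun x => ((q - 1) * q ^+ n)%:E * (\1_[set` `[- w - r n, - w + r n]] x)%:E)%E.
  by apply/funext => x; rewrite /term -r_itv -EFinM.
rewrite ge0_integralZl_EFin//; last exact/measurable_EFinP/measurable_indic.
rewrite integral_indic//.
apply: (@le_trans _ _ (((q - 1) * q ^+ n)%:E * (2 * r n)%:E)%E).
  rewrite lee_wpmul2l ?lee_fin//.
  apply: (le_trans (measureIl _ _ _)) => //.
  rewrite [leLHS]lebesgue_measure_itv/= lte_fin; case: ifP => _.
    by rewrite -EFinB lee_fin; lra.
  by rewrite lee_fin mulr_ge0.
rewrite -EFinM lee_fin.
have -> : (9 / 10) ^+ n = q ^+ n * r n :> R.
  rewrite /q /r exprM -exprMn; congr (_ ^+ n); lra.
by rewrite le_eqVlt; apply/orP; left; apply/eqP; ring.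
Qed.

Lemma integral_step_majorant (w : R) :
  (\int[lebesgue_measure]_(x in `[0%R, 1%R]) step_majorant (w + x)%R <= 12%:E)%E.
Proof.
have mtw n : measurable_fun [set: measurableTypeR R] (fun x => term n (w + x)).
  apply: (measurableT_comp (mterm n)).
  exact: measurable_funD.
rewrite (@ge0_integralD _ _ _ lebesgue_measure _ _ (cst 1%E))//; last 2 first.
- by move=> x _; apply: nneseries_ge0 => n _ _; exact: term_ge0.
- apply: ge0_emeasurable_sum => [n x _ _|n _]; first exact: term_ge0.
  apply: measurable_funTS; exact: mtw.
rewrite integral_cst//= lebesgue_measure_itv/= lte01 oppr0 adde0 mul1e.
rewrite integral_nneseries//; last 2 first.
- by move=> n; apply: measurable_funTS; exact: mtw.
- by move=> n x _; exact: term_ge0.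
(* The geometric series of ratio 9/10 sums to 20 (q - 1), about 10.48, which is below 11. *)
have -> : 12%:E = (1 + 11%:E :> \bar R)%E by rewrite -EFinD; congr _%:E; lra.
rewrite leeD2l//.
apply: le_trans (lee_nneseries _ (fun n _ => integral_term n w)) _.
  by move=> n _ _; apply: integral_ge0 => x _; exact: term_ge0.
apply: lime_le.
  apply: is_cvg_nneseries => n _ _; rewrite lee_fin.
  by rewrite !mulr_ge0 ?exprn_ge0// subr_ge0 ltW.
near=> n; rewrite sumEFin lee_fin.
have := @geometric_le_lim R n (2 * (q - 1)) (9 / 10).
rewrite /series/= => /(_ _ _ _)/le_trans; apply.
- by rewrite mulr_ge0// subr_ge0 ltW.
- lra.
- by rewrite ger0_norm; lra.
- have -> : 1 - 9 / 10 = 10^-1 :> R by lra.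
  rewrite /q invrK; lra.
Unshelve. all: end_near. Qed.
End step_majorant.

(** * Volume of the unit cube, iterated integrals and averages of affine forms *)

Lemma measurable_unit_cube (R : realType) (k : nat) :
  measurable (unit_cube R k).
Proof.
rewrite (_ : unit_cube R k =
  \big[setI/setT]_(i < k) ((@tnth k _)^~ i @^-1` `[0, 1]%classic)).
  apply: bigsetI_measurable => i _.
  by rewrite -[X in measurable X]setTI; exact: measurable_tnth.
rewrite -bigcap_seq; apply/seteqP; split=> s /= h i.
  by move=> _; rewrite /= in_itv/=; exact: h.
by have := h i (mem_index_enum _); rewrite /= in_itv.
Qed.

Lemma unit_cubeS (R : realType) (k : nat) :
  @tuple_cons R k @^-1` unit_cube R k.+1 = `[0, 1]%classic `*` unit_cube R k.
Proof.
apply/seteqP; split=> -[x s] /=.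
  move=> h; split; first by rewrite in_itv/=; exact: (h ord0).
  by move=> i; have := h (lift ord0 i); rewrite tnthS.
rewrite in_itv/= => -[h0 h] i.
by case: (unliftP ord0 i) => [j ->|->]; rewrite ?tnthS//; exact: h.
Qed.

Lemma lebesgue_measure_tuple_unit_cube (R : realType) (k : nat) :
  lebesgue_measure_tuple k (unit_cube R k) = 1%E.
Proof.
rewrite (_ : unit_cube R k = [set s | forall i, `[0, 1]%classic (tnth s i)]).
  rewrite (lebesgue_measure_tuple_box (A := fun=> `[0, 1]%classic))//.
  by rewrite big1// => i _; rewrite lebesgue_measure_itv/= lte01 oppr0 adde0.
by apply/seteqP; split=> s /= h i; have := h i; rewrite /= in_itv.
Qed.

Section integral_unit_cubeS.
Context (R : realType) (k : nat).
Variable G : k.+1.-tuple (measurableTypeR R) -> \bar R.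
Hypothesis mG : measurable_fun [set: k.+1.-tuple (measurableTypeR R)] G.
Hypothesis G0 : forall a, (0 <= G a)%E.
Local Open Scope ereal_scope.

Let mGc : measurable_fun setT (G \o @tuple_cons R k).
Proof. by apply: measurableT_comp => //; exact: measurable_tuple_cons. Qed.

Let I : set (measurableTypeR R * k.-tuple (measurableTypeR R)) :=
  `[0%R, 1%R]%classic `*` unit_cube R k.

Let mI : measurable I.
Proof. by apply: measurableX => //; exact: measurable_unit_cube. Qed.

(** Extension by zero moves the integral to the whole product space, where Tonelli's theorem
    applies. *)
Let F : measurableTypeR R * k.-tuple (measurableTypeR R) -> \bar R :=
  (G \o @tuple_cons R k) \_ I.

Let mF : measurable_fun setT F.
Proof. by apply/(measurable_restrictT _ _).1 => //; exact: measurable_funTS. Qed.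

Let F0 x : 0 <= F x.
Proof. by apply: erestrict_ge0 => t _; exact: G0. Qed.

Let cubeE : \int[lebesgue_measure_tuple k.+1]_(a in unit_cube R k.+1) G a =
  \int[lebesgue_measure \x lebesgue_measure_tuple k]_z F z.
Proof.
rewrite [LHS](ge0_integral_pushforward (@measurable_tuple_cons R k)
  (lebesgue_measure \x lebesgue_measure_tuple k)) //.
- by rewrite unit_cubeS integral_mkcond.
- exact: measurable_unit_cube.
- exact: measurable_funTS.
Qed.

Let fubini_FE : fubini_F (lebesgue_measure_tuple k) F =
  (fun x => \int[lebesgue_measure_tuple k]_(s in unit_cube R k)
    G (tuple_cons (x, s))) \_ `[0%R, 1%R]%classic.
Proof.
apply/funext => x; rewrite patchE /fubini_F; case: ifPn => x01.
  rewrite [RHS]integral_mkcond; apply: eq_integral => s _.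
  by rewrite /F !patchE in_setX x01.
by apply: integral0_eq => s _; rewrite /F patchE in_setX (negbTE x01).
Qed.

Let fubini_GE : fubini_G lebesgue_measure F =
  (fun s => \int[lebesgue_measure]_(x in `[0%R, 1%R])
    G (tuple_cons (x, s))) \_ (unit_cube R k).
Proof.
apply/funext => s; rewrite patchE /fubini_G; case: ifPn => sC.
  rewrite [RHS]integral_mkcond; apply: eq_integral => x _.
  by rewrite /F !patchE in_setX sC andbT.
by apply: integral0_eq => x _; rewrite /F patchE in_setX (negbTE sC) andbF.
Qed.

Lemma measurable_integral_unit_cubeS1 :
  measurable_fun (`[0%R, 1%R]%classic : set (measurableTypeR R))
    (fun x => \int[lebesgue_measure_tuple k]_(s in unit_cube R k)
      G (tuple_cons (x, s))).
Proof.
apply/(measurable_restrictT _ _).2 => //; rewrite -fubini_FE.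
exact: measurable_fun_fubini_tonelli_F.
Qed.

Lemma measurable_integral_unit_cubeS2 :
  measurable_fun (unit_cube R k)
    (fun s => \int[lebesgue_measure]_(x in `[0%R, 1%R]) G (tuple_cons (x, s))).
Proof.
apply/(measurable_restrictT _ _).2; first exact: measurable_unit_cube.
by rewrite -fubini_GE; exact: measurable_fun_fubini_tonelli_G.
Qed.

(** With the first coordinate outermost, the inner integral is again over a cube, which suits an
    induction on the dimension. *)
Lemma integral_unit_cubeS1 :
  \int[lebesgue_measure_tuple k.+1]_(a in unit_cube R k.+1) G a =
  \int[lebesgue_measure]_(x in `[0%R, 1%R])
    \int[lebesgue_measure_tuple k]_(s in unit_cube R k) G (tuple_cons (x, s)).
Proof.
by rewrite cubeE (fubini_tonelli1 _ mF F0) fubini_FE [RHS]integral_mkcond.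
Qed.

(** With the first coordinate innermost, a one-dimensional bound uniform in the other coordinates
    can be used at once. *)
Lemma integral_unit_cubeS2 :
  \int[lebesgue_measure_tuple k.+1]_(a in unit_cube R k.+1) G a =
  \int[lebesgue_measure_tuple k]_(s in unit_cube R k)
    \int[lebesgue_measure]_(x in `[0%R, 1%R]) G (tuple_cons (x, s)).
Proof.
by rewrite cubeE (fubini_tonelli2 _ mF F0) fubini_GE [RHS]integral_mkcond.
Qed.

End integral_unit_cubeS.

Lemma measurable_affine_form (R : realType) (k : nat) (r : 'I_k -> R) (w : R) :
  measurable_fun [set: k.-tuple (measurableTypeR R)]
    (fun a => w + \sum_i tnth a i * r i : measurableTypeR R).
Proof.
apply: measurable_funD => //; apply: measurable_sum => i.
by apply: measurable_funM => //; exact: measurable_tnth.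
Qed.

(** Induction on the dimension. Coordinates held fixed only shift [w], and both the hypothesis on
    [h] and the conclusion are uniform in [w]. *)
Lemma integral_unit_cube_le (R : realType) (h : measurableTypeR R -> \bar R)
    (C : \bar R) :
  measurable_fun setT h -> (forall x, (0 <= h x)%E) ->
  (forall w : R, (\int[lebesgue_measure]_(x in `[0%R, 1%R]) h (w + x)%R <= C)%E) ->
  forall (k : nat) (j : 'I_k) (r : 'I_k -> R) (w : R), r j = 1 ->
  (\int[lebesgue_measure_tuple k]_(a in unit_cube R k)
     h (w + \sum_i tnth a i * r i)%R <= C)%E.
Proof.
move=> mh h0 hC.
have C0 : (0 <= C)%E by apply: le_trans (hC 0); exact: integral_ge0.
elim=> [[]//|k IH] j r w rj.
have mG := measurableT_comp mh (measurable_affine_form r w).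
have sumE (x : R) (s : k.-tuple R) :
    \sum_i tnth (tuple_cons (x, s)) i * r i =
    x * r ord0 + \sum_i tnth s i * r (lift ord0 i).
  by rewrite big_ord_recl/=; congr (_ + _); apply: eq_bigr => i _; rewrite tnthS.
(* If [j] is not the first index, the first coordinate is fixed and the induction hypothesis bounds
   the rest; if it is, that coordinate is integrated first, with coefficient 1. *)
case: (unliftP ord0 j) rj => [i ->|->] rj.
- rewrite integral_unit_cubeS1//.
  apply: (@le_trans _ _ (\int[lebesgue_measure]_(x in `[0%R, 1%R]%classic) cst C x)%E).
    apply: ge0_le_integral => //.
    + by move=> x _; apply: integral_ge0 => s _; exact: h0.
    + by apply: (measurable_integral_unit_cubeS1 mG) => x; exact: h0.
    + move=> x _; rewrite /=.
      under eq_integral do rewrite sumE addrA.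
      apply: (IH i (fun i => r (lift ord0 i))); exact: rj.
  rewrite integral_cst// [X in (_ * X)%E]lebesgue_measure_itv/= lte01.
  by rewrite oppr0 adde0 mule1.
- rewrite integral_unit_cubeS2//.
  apply: (@le_trans _ _ (\int[lebesgue_measure_tuple k]_(s in unit_cube R k) cst C s)%E).
    apply: ge0_le_integral => //.
    + exact: measurable_unit_cube.
    + by move=> s _; apply: integral_ge0 => x _; exact: h0.
    + by apply: (measurable_integral_unit_cubeS2 mG) => x; exact: h0.
    + move=> s _; rewrite /=.
      under eq_integral do rewrite sumE rj mulr1 addrCA addrC.
      exact: hC.
  rewrite integral_cst; last exact: measurable_unit_cube.
  by rewrite [X in (_ * X)%E]lebesgue_measure_tuple_unit_cube mule1.
Qed.

(** * Complex linear forms with a unit coefficient vector *)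

Section complex_facts.
Context (R : realType).
Implicit Types (z : R[i]).
Local Open Scope complex_scope.

Lemma normr_Re_le z : `|complex.Re z| <= normc z.
Proof. by case: z => a b /=; rewrite -sqrtr_sqr ler_wsqrtr// lerDl sqr_ge0. Qed.

Lemma normc_ge0 z : 0 <= normc z.
Proof. exact: le_trans (normr_Re_le z). Qed.

Lemma Re_lincomb (k : nat) (a : 'I_k -> R) (z : 'I_k -> R[i]) :
  complex.Re (\sum_i (a i)%:C * z i) = \sum_i a i * complex.Re (z i).
Proof.
elim/big_rec2: _ => //= i y1 [y2 y3] _ /= <-.
by case: (z i) => b c /=; rewrite mul0r subr0.
Qed.

Lemma Im_lincomb (k : nat) (a : 'I_k -> R) (z : 'I_k -> R[i]) :
  complex.Im (\sum_i (a i)%:C * z i) = \sum_i a i * complex.Im (z i).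
Proof.
elim/big_rec2: _ => //= i y1 [y2 y3] _ /= <-.
by case: (z i) => b c /=; rewrite mul0r addr0.
Qed.

Lemma normc_sum_le (k : nat) (z : 'I_k -> R[i]) :
  normc (\sum_i z i) <= \sum_i normc (z i).
Proof.
elim/big_ind2: _ => // [|x1 x2 y1 y2 h1 h2]; first by rewrite normc0.
exact: le_trans (le_normcD _ _) (lerD h1 h2).
Qed.

Lemma cpairing_realE (k : nat) (a : k.-tuple R) (u : k.-tuple R[i]) :
  cpairing (tuple_real_complex a) u = \sum_i (tnth a i)%:C * tnth u i.
Proof. by apply: eq_bigr => i _; rewrite tnth_map. Qed.

End complex_facts.

Section unit_vector.
Context (R : realType) (k : nat) (u : k.-tuple R[i]).
Hypothesis u1 : cnorm u = 1.

Let sum1 : \sum_i normc (tnth u i) ^+ 2 = 1.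
Proof.
rewrite -[LHS]sqr_sqrtr; last by apply: sumr_ge0 => i _; exact: sqr_ge0.
by rewrite -/(cnorm u) u1 expr1n.
Qed.

Lemma normc_coord_le1 i : normc (tnth u i) <= 1.
Proof.
rewrite -(@expr_le1 _ 2)// ?normc_ge0// -sum1 (bigD1 i)//= lerDl.
by apply: sumr_ge0 => j _; exact: sqr_ge0.
Qed.

(** Otherwise k |u_i|^2 < 1 for every [i], and summing gives k < k. The strict sum requires an index
    to exist; without one the norm would be 0. *)
Lemma exists_large_coord : exists j, 1 <= Num.sqrt k%:R * normc (tnth u j).
Proof.
apply/not_existsP => h.
have [i0 _|no] := pickP (predT : pred 'I_k); last first.
  by move/eqP: sum1; rewrite big_pred0// eq_sym oner_eq0.
have : \sum_(i < k) (k%:R * normc (tnth u i) ^+ 2) < \sum_(i < k) 1.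
  apply: ltr_sum => [|i _]; first by apply/hasP; exists i0; rewrite ?mem_index_enum.
  have /negP := h i; rewrite -ltNge => hi.
  rewrite -[k%:R]sqr_sqrtr// -exprMn expr_lt1// mulr_ge0 ?sqrtr_ge0//.
  exact: normc_ge0.
by rewrite -mulr_sumr sum1 mulr1 sumr_const card_ord ltxx.
Qed.

(** Triangle inequality: each of the k terms has modulus at most 1. *)
Lemma normc_cpairing_le a : unit_cube R k a ->
  normc (cpairing (tuple_real_complex a) u) <= k%:R.
Proof.
move=> ha; rewrite cpairing_realE (le_trans (normc_sum_le _))//.
rewrite -[k in leRHS]card_ord -sumr_const; apply: ler_sum => i _.
have /andP[a0 a1] := ha i.
rewrite normcM -[leRHS]mulr1 ler_pM ?normc_ge0 ?normc_coord_le1//.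
by rewrite /= expr0n addr0 sqrtr_sqr ger0_norm.
Qed.

(** Dividing by u_j gives a_j the coefficient 1, and costs at most a factor sqrt k because |u_j| is
    at least 1 / sqrt k. *)
Lemma normr_Re_quotient_le (j : 'I_k) (a : k.-tuple R) :
  1 <= Num.sqrt k%:R * normc (tnth u j) ->
  `| \sum_i tnth a i * complex.Re (tnth u i / tnth u j) | <=
  Num.sqrt k%:R * normc (cpairing (tuple_real_complex a) u).
Proof.
move=> hj.
have uj0 : 0 < normc (tnth u j).
  rewrite lt_neqAle normc_ge0 andbT eq_sym; apply/eqP => z.
  by move: hj; rewrite z mulr0 ler10.
rewrite -Re_lincomb (le_trans (normr_Re_le _))//.
under eq_bigr do rewrite mulrA.
rewrite -mulr_suml -cpairing_realE normcM normcV ler_pdivrMr// mulrAC.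
by rewrite ler_peMl// normc_ge0.
Qed.

End unit_vector.

(** * Measurability of the integrand and the final estimate *)

Lemma measurable_lne_EFin (R : realType) :
  measurable_fun [set: measurableTypeR R] (fun x : R => lne x%:E).
Proof.
apply: measurable_fun_ifT => //=.
- by apply: measurable_fun_ler.
- by apply/measurable_EFinP; apply: measurable_ln.
Qed.

Lemma measurable_normc_cpairing (R : realType) (k : nat) (u : k.-tuple R[i]) :
  measurable_fun [set: k.-tuple (measurableTypeR R)]
    (fun a => normc (cpairing (tuple_real_complex a) u) : measurableTypeR R).
Proof.
have mlin (r : 'I_k -> R) : measurable_fun [set: k.-tuple (measurableTypeR R)]
    (fun a => \sum_i tnth a i * r i : measurableTypeR R).
  have := measurable_affine_form r 0.
  by under eq_fun do rewrite add0r.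
rewrite (_ : (fun _ => _) = fun a => Num.sqrt
    ((\sum_i tnth a i * complex.Re (tnth u i)) ^+ 2 +
     (\sum_i tnth a i * complex.Im (tnth u i)) ^+ 2)).
  have msqrt : measurable_fun setT (Num.sqrt : R -> R).
    by apply: continuous_measurable_fun; exact: sqrt_continuous.
  apply: (measurableT_comp msqrt).
  by apply: measurable_funD; apply: measurable_funX; exact: mlin.
apply/funext => a; rewrite cpairing_realE -Re_lincomb -Im_lincomb.
by case: (\sum_i _).
Qed.

(** This adds the degenerate points to [powR_ln_le]. At [s = 0] the right side is [+oo]; [X = 0],
    where [lne] is infinite, forces [s = 0]. *)
Lemma powR_lne_le_majorant (R : realType) (nu K X s : R) :
  1 <= nu -> 1 <= K -> 0 <= X -> X <= K -> `|s| <= Num.sqrt K * X ->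
  ((`| lne X%:E | `^ nu) <=
   (ln K `^ nu)%:E + (nu `^ nu / 2)%:E * step_majorant s)%E.
Proof.
move=> nu1 K1 X0 XK sX; have nu0 : 0 < nu by lra.
have c0 : 0 < nu `^ nu / 2 by rewrite divr_gt0 ?powR_gt0.
have [->|s0] := eqVneq s 0.
  by rewrite step_majorant0 mulry gtr0_sg// mul1e addey ?leey.
have {}X0 : 0 < X.
  rewrite lt_neqAle X0 andbT eq_sym; apply/eqP => XE.
  by move: sX; rewrite XE mulr0 normr_le0 (negbTE s0).
rewrite lne_EFin//=.
apply: (@le_trans _ _ (ln K `^ nu +
    nu `^ nu / 2 * expR (4 / 5 * Num.max 0 (- ln `|s|)))%:E).
  by rewrite lee_fin powR_ln_le.
rewrite EFinD EFinM leeD2l// lee_wpmul2l ?lee_fin ?(ltW c0)//.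
exact: expR_le_step_majorant.
Qed.

Theorem proposition4p7 (R : realType) (k : nat) (nu : R) (u : k.-tuple R[i]) :
  (1 <= k)%N -> 1 <= nu -> cnorm u = 1 ->
  (\int[lebesgue_measure_tuple k]_(a in unit_cube R k)
      (`| lne (normc (cpairing (tuple_real_complex a) u))%:E | `^ nu)
   <= (ln k%:R `^ nu + 6 * nu `^ nu)%:E)%E.
Proof.
move=> k1 nu1 u1.
have [j uj] := exists_large_coord u1.
pose r i := complex.Re (tnth u i / tnth u j).
have rj : r j = 1.
  rewrite /r divff//; apply/eqP => z.
  by move: uj; rewrite z normc0 mulr0 ler10.
(* The summand [0] is the initial shift [w] in [integral_unit_cube_le]. *)
pose s (a : k.-tuple (measurableTypeR R)) := 0 + \sum_i tnth a i * r i.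
have ms : measurable_fun setT (fun a => step_majorant (s a)).
  exact: (measurableT_comp (@measurable_step_majorant R) (measurable_affine_form r 0)).
have mC := @measurable_unit_cube R k.
pose c : R := nu `^ nu / 2.
have c0 : 0 <= c by rewrite divr_ge0 ?powR_ge0.
apply: (@le_trans _ _ (\int[lebesgue_measure_tuple k]_(a in unit_cube R k)
    ((ln k%:R `^ nu)%:E + c%:E * step_majorant (s a)))%E).
  apply: ge0_le_integral => //.
  - by move=> a _; exact: poweR_ge0.
  - apply: measurable_funTS.
    apply: (measurableT_comp (@measurable_poweR R nu)).
    apply: measurableT_comp => //.
    exact: (measurableT_comp (@measurable_lne_EFin R) (measurable_normc_cpairing u)).
  - apply: measurable_funTS; apply: emeasurable_funD => //.
    exact: measurable_funeM.
  - move=> a Ca; apply: powR_lne_le_majorant => //.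
    + by rewrite ler1n.
    + exact: normc_ge0.
    + exact: normc_cpairing_le.
    + by rewrite /s add0r; exact: normr_Re_quotient_le.
rewrite ge0_integralD//; last 3 first.
- by move=> a _; rewrite lee_fin powR_ge0.
- by move=> a _; rewrite mule_ge0 ?lee_fin// step_majorant_ge0.
- by apply: measurable_funTS; exact: measurable_funeM.
rewrite ge0_integralZl_EFin//; last 2 first.
- by move=> a _; exact: step_majorant_ge0.
- exact: measurable_funTS.
rewrite (integral_cst _ mC) [X in (_ * X)%E]lebesgue_measure_tuple_unit_cube mule1.
rewrite EFinD leeD2l//.
(* The average of the majorant is at most 12, and the factor 1/2 in [c] turns this into the constant
   6. *)
have hs := integral_unit_cube_le (@measurable_step_majorant R) (@step_majorant_ge0 R)
  (@integral_step_majorant R) (j := j) (r := r) 0 rj.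
apply: (le_trans (lee_wpmul2l _ hs)); first by rewrite lee_fin.
by rewrite -EFinM lee_fin /c; lra.
Qed.
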